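(* Let $r_n:=|\mathfrak{A}_{2n+1}(2413,3142)|$ for $n\ge0$ and $R(x):=\sum_{n\ge1}r_nx^n$. Then $$R(x)=x(R(x)+1)^2+x(R(x)+1)^3.$$ Consequently $r_0=1$ and for $n\ge1$, $$r_n=\frac{2}{n}\sum_{i=0}^{n-1}2^i\binom{2n}{i}\binom{n}{i+1}.$$
   Context: $\mathfrak{A}_m(2413,3142)$ is the set of permutations $\pi$ of $[m]$ that are alternating (up-down), i.e. $\pi(1)<\pi(2)>\pi(3)<\pi(4)>\cdots$, and avoid both classical patterns $2413$ and $3142$. *)

(* Defs.v *)
From HB Require Import structures.
From mathcomp Require Import all_boot all_order all_algebra all_fingroup.
Set Implicit Arguments. Unset Strict Implicit. Unset Printing Implicit Defensive.
Import Order.TTheory GRing.Theory Num.Theory.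

(* Permutations of [m] are represented as 'S_m = {perm 'I_m}; position i+1
   and value s i + 1 of the paper correspond to i and s i here (0-based,
   order-preserving shift). *)

Definition alternating (m : nat) (s : 'S_m) : bool :=
  [forall i : 'I_m, forall j : 'I_m,
     (val j == (val i).+1) ==>
       (if odd (val i) then s j < s i else s i < s j)].

Definition contains2413 (m : nat) (s : 'S_m) : bool :=
  [exists i : 'I_m, exists j : 'I_m, exists k : 'I_m, exists l : 'I_m,
     [&& i < j, j < k, k < l, s k < s i, s i < s l & s l < s j]].

Definition contains3142 (m : nat) (s : 'S_m) : bool :=
  [exists i : 'I_m, exists j : 'I_m, exists k : 'I_m, exists l : 'I_m,
     [&& i < j, j < k, k < l, s j < s l, s l < s i & s i < s k]].

Definition Aset (m : nat) : {set 'S_m} :=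
  [set s : 'S_m | [&& alternating s, ~~ contains2413 s & ~~ contains3142 s]].

Definition r (n : nat) : nat := #|Aset (2 * n).+1|.

Definition Rtrunc (N : nat) : {poly int} :=
  \sum_(1 <= n < N.+1) ((r n)%:R *: 'X^n).

(* Main.v *)
Require Import Defs.
From HB Require Import structures.
From mathcomp Require Import all_boot all_order all_algebra all_fingroup.
From mathcomp Require Import zify ring.
Import Order.TTheory GRing.Theory Num.Theory.
Local Open Scope ring_scope.
Set Implicit Arguments. Unset Strict Implicit. Unset Printing Implicit Defensive.

(* A separable word with at least two letters splits, in exactly one of the two
   ways, into a prefix and a suffix with all letters of the prefix below
   (sum) or above (skew sum) those of the suffix; the shortest such prefix is
   itself not a sum (resp. skew sum), which makes the splitting unique. In an
   alternating word the parity of the prefix is forced by the direction of the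
   step at the cut. Complementation exchanges sums and skew sums, so that,
   [x] marking half the length, the series [A = 1 + R] (odd lengths), [E] (even
   positive lengths), [Q] (odd, starting upwards, not a sum) and [C] (even,
   starting upwards, a sum) satisfy
     A = Q + Q E,   Q = 1 + C A,   C = x Q A,   E = C + C E.
   Eliminating gives [A = 1 + x A^2 + x A^3], and the closed form is Lagrange's
   formula for [R = x phi(R)] with [phi = (1 + t)^2 (2 + t)]. *)

(** * Separable words, up to reversal of the order *)

Section Words.
Local Open Scope nat_scope.
Implicit Types (b c : bool) (u v w : seq nat) (m k : nat).

(* [true] stands for the usual order on the letters and [false] for the
   reversed one. *)
Definition ordb c : rel nat := fun x y => if c then x < y else y < x.

Lemma ordb_trans c : transitive (ordb c).
Proof. by case: c => y x z; rewrite /ordb; lia. Qed.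

Lemma ordbN c x y : ordb (~~ c) x y = ordb c y x.
Proof. by case: c. Qed.

Lemma ordb_asym c c' x y : ordb c x y -> ordb c' x y = (c' == c).
Proof.
by case: c c' => [] []; rewrite /ordb => h; rewrite ?h //; apply: negbTE; lia.
Qed.

Lemma ordb_total c x y : x != y -> ~~ ordb c x y -> ordb c y x.
Proof. by case: c; rewrite /ordb; lia. Qed.

Definition pat4 c a1 a2 a3 a4 :=
  [&& ordb c a3 a1, ordb c a1 a4 & ordb c a4 a2].

(* The patterns 2413 and 3142 are exchanged by complementation. *)
Definition bad4 a1 a2 a3 a4 := pat4 true a1 a2 a3 a4 || pat4 false a1 a2 a3 a4.

Lemma bad4E c a1 a2 a3 a4 :
  bad4 a1 a2 a3 a4 = pat4 c a1 a2 a3 a4 || pat4 (~~ c) a1 a2 a3 a4.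
Proof. by case: c => //; rewrite /bad4 orbC. Qed.

Definition separable w :=
  all (fun a1 => all (fun a2 => all (fun a3 => all (fun a4 =>
    subseq [:: a1; a2; a3; a4] w ==> ~~ bad4 a1 a2 a3 a4) w) w) w) w.

Lemma separableP w :
  reflect (forall a1 a2 a3 a4, subseq [:: a1; a2; a3; a4] w ->
             ~~ bad4 a1 a2 a3 a4)
          (separable w).
Proof.
apply: (iffP allP) => [h a1 a2 a3 a4 s | h a1 _].
  have /allP s4 : all (mem w) [:: a1; a2; a3; a4].
    by apply/allP => x xs; apply: (mem_subseq s).
  have := h a1 (s4 _ _); rewrite !inE eqxx => /(_ isT).
  move=> /allP/(_ a2 (s4 _ _)); rewrite !inE eqxx ?orbT => /(_ isT).
  move=> /allP/(_ a3 (s4 _ _)); rewrite !inE eqxx ?orbT => /(_ isT).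
  move=> /allP/(_ a4 (s4 _ _)); rewrite !inE eqxx ?orbT => /(_ isT).
  by move/implyP; apply.
apply/allP => a2 _; apply/allP => a3 _; apply/allP => a4 _.
by apply/implyP; apply: h.
Qed.

Lemma separable_subseq u w : subseq u w -> separable w -> separable u.
Proof.
move=> uw /separableP h; apply/separableP => a1 a2 a3 a4 s.
exact: h (subseq_trans s uw).
Qed.

Lemma subseq_map_exists (T1 T2 : eqType) (f : T1 -> T2) (t : seq T2) (s : seq T1) :
  subseq t (map f s) -> exists2 t', subseq t' s & t = map f t'.
Proof.
case/subseqP => ma _ ->; exists (mask ma s); first exact: mask_subseq.
by rewrite map_mask.
Qed.

(** Taking [c] false covers order-reversing maps, under which the two patterns are exchanged. *)
Lemma separable_map c f w :
    {in w &, forall x y, ordb c (f x) (f y) = (x < y)} ->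
  separable w -> separable (map f w).
Proof.
move=> fw /separableP h; apply/separableP => b1 b2 b3 b4.
case/subseq_map_exists => -[|a1 [|a2 [|a3 [|a4 []]]]] // s [-> -> -> ->].
have /allP s4 : all (mem w) [:: a1; a2; a3; a4].
  by apply/allP => x xs; apply: (mem_subseq s).
have {fw} fw x y : x \in [:: a1; a2; a3; a4] -> y \in [:: a1; a2; a3; a4] ->
    ordb c (f x) (f y) = ordb true x y.
  by move=> xs ys; apply: fw; exact: s4.
move: (h _ _ _ _ s).
by rewrite (bad4E c (f a1)) (bad4E true) /pat4 !ordbN !fw ?inE ?eqxx ?orbT.
Qed.

Lemma subseq_cat_exists (T : eqType) (t s1 s2 : seq T) :
  subseq t (s1 ++ s2) ->
  exists t1 t2, [/\ t = t1 ++ t2, subseq t1 s1 & subseq t2 s2].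
Proof.
case/subseqP => ma sz ->.
exists (mask (take (size s1) ma) s1), (mask (drop (size s1) ma) s2).
split; try exact: mask_subseq.
rewrite -{1}(cat_take_drop (size s1) ma) mask_cat //.
by rewrite size_takel // sz size_cat leq_addr.
Qed.

(** Neither pattern is a sum or a skew sum, so no occurrence can straddle the cut. The cases run
    over the number of its letters lying in [u]. *)
Lemma separable_cat c u v :
  allrel (ordb c) u v -> separable u -> separable v -> separable (u ++ v).
Proof.
move=> /allrelP uv /separableP su /separableP sv.
apply/separableP => a1 a2 a3 a4 /subseq_cat_exists[t1 [t2 []]].
case: t1 => [|x1 [|x2 [|x3 [|x4 [|x5 t1]]]]] //=.
- by move=> <- _; apply: sv.
- move=> [<- <-] /mem_subseq m1 /mem_subseq m2.
  have h x : x \in [:: a2; a3; a4] -> ordb c a1 x.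
    by move=> xs; apply: uv; [apply: m1; rewrite inE | apply: m2].
  move: (h a2) (h a3) (h a4); rewrite !inE !eqxx !orbT.
  by rewrite /bad4 /pat4 /ordb; case: (c) => /(_ isT) + /(_ isT) + /(_ isT); lia.
- move=> [<- <- <-] /mem_subseq m1 /mem_subseq m2.
  have h x y : x \in [:: a1; a2] -> y \in [:: a3; a4] -> ordb c x y.
    by move=> xs ys; apply: uv; [apply: m1 | apply: m2].
  move: (h a1 a3) (h a1 a4) (h a2 a3) (h a2 a4); rewrite !inE !eqxx !orbT.
  rewrite /bad4 /pat4 /ordb.
  by case: (c) => /(_ isT isT) + /(_ isT isT) + /(_ isT isT) + /(_ isT isT); lia.
- move=> [<- <- <- <-] /mem_subseq m1 /mem_subseq m2.
  have h x : x \in [:: a1; a2; a3] -> ordb c x a4.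
    by move=> xs; apply: uv; [apply: m1 | apply: m2; rewrite inE].
  move: (h a1) (h a2) (h a3); rewrite !inE !eqxx !orbT.
  by rewrite /bad4 /pat4 /ordb; case: (c) => /(_ isT) + /(_ isT) + /(_ isT); lia.
- move=> [<- <- <- <- t20] s1 _; exact: su.
Qed.

(** * Cutting words into sums and skew sums *)

Definition cut c w k :=
  [&& 0 < k, k < size w & allrel (ordb c) (take k w) (drop k w)].

Definition decomposable c w := has (cut c w) (iota 0 (size w)).

Lemma decomposableP c w :
  reflect (exists u v, [/\ w = u ++ v, 0 < size u, 0 < size v &
                           allrel (ordb c) u v])
          (decomposable c w).
Proof.
apply: (iffP hasP) => [[k _ /and3P[k0 kw h]] | [u [v [-> u0 v0 h]]]].
  exists (take k w), (drop k w); rewrite cat_take_drop size_drop subn_gt0.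
  by rewrite size_takel ?(ltnW kw).
exists (size u); first by rewrite mem_iota size_cat; lia.
by rewrite /cut size_cat u0 take_size_cat // drop_size_cat // h; lia.
Qed.

(** The first and the last letter lie on opposite sides of any cut, so their order tells which kind
    of splitting it is. *)
Lemma decomposable_disjoint w : decomposable true w -> ~~ decomposable false w.
Proof.
have hl c : decomposable c w -> ordb c (head 0 w) (last 0 w).
  case/decomposableP => -[|x u] [v [-> //= _ v0 /allrelP h]].
  rewrite last_cat; apply: h; rewrite ?mem_head //.
  by case: v v0 => //= y v _; rewrite mem_last.
by move=> /hl h; apply/negP => /hl; move: h; rewrite /ordb; lia.
Qed.

(* Induction on the last letter [a]: if the remaining word is [u ++ v] with
   [u < v], then avoiding 3142 forces the letters of [u] below [a] to come
   before those above [a]. *)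
Lemma separable_decomposable w :
  uniq w -> separable w -> 1 < size w ->
  exists c, decomposable c w.
Proof.
elim/last_ind: w => // w a IH; rewrite rcons_uniq size_rcons => /andP[aw wu] sw.
rewrite ltnS => w0.
have [w1|w1] := leqP (size w) 1.
  case: w w1 w0 aw {IH sw wu} => [|x []] //= _ _; rewrite inE => xa.
  exists (x < a); apply/decomposableP; exists [:: x], [:: a]; split => //.
  by rewrite /allrel /= /ordb; case: ltngtP xa.
have /IH -/(_ wu w1) [c] : separable w.
  by apply: separable_subseq sw; apply: subseq_rcons.
case/decomposableP => u [v [wE u0 v0 /allrelP uv]].
have aordb x : x \in w -> ~~ ordb c x a -> ordb c a x.
  by move=> xw; apply: ordb_total; apply: contraNneq aw => <-.
(* If no letter of [u] precedes [a] for the order [c], then [a] precedes all of [u], hence all of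
   [v], and cutting off [a] alone splits the word in the opposite order. *)
have [/hasP[x xu xa]|/hasPn nu] := boolP (has (ordb c ^~ a) u); last first.
  exists (~~ c); apply/decomposableP; exists w, [:: a]; split => //.
    by rewrite cats1.
  apply/allrelP => x y xw; rewrite inE => /eqP ->; rewrite ordbN.
  move: xw; rewrite wE mem_cat => /orP[xu|xv].
    by apply: aordb; [rewrite wE mem_cat xu | apply: nu].
  case: u u0 wE uv nu => // z u _ wE uv nu.
  apply: ordb_trans (uv z x (mem_head _ _) xv).
  by apply: aordb; [rewrite wE mem_head | apply: nu; rewrite mem_head].
pose k := find (fun y => ~~ ordb c y a) u.
pose u1 := take k u; pose u2 := drop k u.
have uE : u = u1 ++ u2 by rewrite cat_take_drop.
have u1a y : y \in u1 -> ordb c y a.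
  move=> yu1; have := before_find a (i := index y u1)
    (a := fun y => ~~ ordb c y a) (s := u).
  rewrite -/k.
  have ik : index y u1 < k.
    have := index_mem y u1; rewrite yu1 => h.
    by apply: leq_trans h _; rewrite size_take; case: ltnP.
  move=> /(_ ik) /negbFE.
  by rewrite -(nth_take a ik) -/u1 nth_index.
have u2a y : y \in u2 -> ordb c a y.
  move=> yu2; have yw : y \in w by rewrite wE uE !mem_cat yu2 orbT.
  apply: (aordb y yw); apply/negP => ya.
  have kl : k < size u.
    by rewrite ltnNge; apply: contraTN yu2 => h; rewrite /u2 drop_oversize.
  have zE := drop_nth a kl; set z := nth a u k in zE.
  have za : ~~ ordb c z a.
    by apply: (nth_find a (a := fun y => ~~ ordb c y a)); rewrite has_find.
  have zw : z \in w by rewrite wE mem_cat mem_nth.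
  have yz : y != z by apply: contraNneq za => <-.
  move: yu2; rewrite /u2 zE inE (negbTE yz) /= => yd.
  (* With [z] the first letter of [u2] and [t] in [v], a letter [y] of [u2] on the wrong side of [a]
     makes [z y t a] an occurrence of 3142 or of its complement. *)
  case: v v0 uv wE => // t v _ uv wE.
  have /separableP/(_ z y t a) : separable (rcons w a) by [].
  rewrite (bad4E (~~ c)) /pat4 !ordbN ya (aordb z zw za) uv ?mem_nth ?mem_head //=.
  move=> h; suff: subseq [:: z; y; t; a] (rcons w a) by move/h.
  rewrite wE uE /u2 zE -cats1 -!catA.
  apply: subseq_trans (suffix_subseq _ _); rewrite /= eqxx.
  rewrite -[[:: y; t; a]]/([:: y] ++ [:: t; a]).
  apply: cat_subseq; first by rewrite sub1seq.
  by rewrite /= eqxx -[[:: a]]cat0s; apply: cat_subseq; rewrite ?sub0seq.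
exists c; apply/decomposableP; exists u1, (rcons (u2 ++ v) a); split.
- by rewrite -rcons_cat catA -uE -wE.
- case E : u1 => //; move: uE u2a; rewrite E /= => <- /(_ x xu) h.
  by move: h xa; rewrite -ordbN => /ordb_asym ->; case: (c).
- by rewrite size_rcons.
- apply/allrelP => y z yu1; rewrite mem_rcons inE mem_cat.
  have yu : y \in u by rewrite uE mem_cat yu1.
  case/or3P => [/eqP -> | zu2 | zv]; [exact: u1a | | exact: uv].
  exact: ordb_trans (u1a _ yu1) (u2a _ zu2).
Qed.

(** * Alternating words *)

Fixpoint alt b w :=
  if w is x :: w' then
    (if w' is y :: _ then ordb b x y else true) && alt (~~ b) w'
  else true.

Lemma alt_map b c f w :
    {in w &, forall x y, ordb c (f x) (f y) = (x < y)} ->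
  alt (if c then b else ~~ b) (map f w) = alt b w.
Proof.
elim: w b => //= x w IH b fw.
have fo d : {in x :: w &, forall y z,
    ordb (if c then d else ~~ d) (f y) (f z) = ordb d y z}.
  by case: c d fw {IH} => [] [] fw y z yw zw; [exact: (fw y z) | exact: (fw z y)
    | exact: (fw y z) | exact: (fw z y)].
have -> : ~~ (if c then b else ~~ b) = if c then ~~ b else ~~ ~~ b by case: (c).
rewrite IH; last by move=> y z yw zw; apply: fw; rewrite inE ?yw ?zw orbT.
by case: w fo {IH fw} => //= y w -> //; rewrite !inE eqxx ?orbT.
Qed.

(** The suffix starts in direction [b (+) odd (size u)], so the step across the cut must have the
    opposite direction, while the relation between [u] and [v] makes it go in direction [c]. *)
Lemma alt_cat b c u v :
    0 < size u -> 0 < size v -> allrel (ordb c) u v ->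
  alt b (u ++ v) =
  [&& alt b u, alt (b (+) odd (size u)) v & (b (+) odd (size u)) != c].
Proof.
elim: u b => // x [|x' u] IH b _ v0; rewrite allrel_consl => /andP[xv uv].
  case: v v0 xv uv {IH} => //= y v _ /andP[/ordb_asym-> _] _.
  by rewrite addbT andbC; case: b c => [] [].
have -> : alt b ((x :: x' :: u) ++ v) = ordb b x x' && alt (~~ b) ((x' :: u) ++ v).
  by [].
rewrite IH // -[odd (size (x :: _))]/(~~ odd (size (x' :: u))) addbN -addNb.
by rewrite [alt b _]/= -andbA.
Qed.

(** * Families of words and complementation *)

Definition words m b :=
  [seq w <- permutations (iota 0 m) | separable w && alt b w].

Definition dwords m b c := [seq w <- words m b | decomposable c w].

Definition iwords m b := [seq w <- words m b | ~~ decomposable true w].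

Lemma mem_words m b w :
  (w \in words m b) = [&& separable w, alt b w & perm_eq w (iota 0 m)].
Proof. by rewrite mem_filter mem_permutations andbA. Qed.

Lemma words_uniq m b : uniq (words m b).
Proof. exact/filter_uniq/permutations_uniq. Qed.

Lemma size_words_perm m b w : w \in words m b -> size w = m.
Proof. by rewrite mem_words => /and3P[_ _ /perm_size ->]; rewrite size_iota. Qed.

Lemma mem_perm_iota m w x : perm_eq w (iota 0 m) -> (x \in w) = (x < m).
Proof. by move=> /perm_mem ->; rewrite mem_iota. Qed.

Lemma perm_iota_compl m w : perm_eq w (iota 0 m) ->
  perm_eq [seq m.-1 - x | x <- w] (iota 0 m).
Proof.
move=> wm; apply: uniq_perm; rewrite ?iota_uniq //.
  rewrite map_inj_in_uniq ?(perm_uniq wm) ?iota_uniq // => x y.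
  by rewrite !(mem_perm_iota _ wm); lia.
move=> x; rewrite mem_iota add0n /=; apply/mapP/idP => [[y]|xm].
  by rewrite (mem_perm_iota _ wm) => ym ->; lia.
by exists (m.-1 - x); rewrite ?(mem_perm_iota _ wm); lia.
Qed.

(** Complementation [x -> m.-1 - x] is an involution on the letters below [m], so an inequality
    valid for all parameters suffices. *)
Lemma size_dwords_compl m b c : size (dwords m b c) = size (dwords m (~~ b) (~~ c)).
Proof.
suff le d e : size (dwords m d e) <= size (dwords m (~~ d) (~~ e)).
  by apply/eqP; rewrite eqn_leq le /=; have := le (~~ b) (~~ c); rewrite !negbK.
pose f x := m.-1 - x.
have fP w : perm_eq w (iota 0 m) ->
    {in w &, forall x y, ordb false (f x) (f y) = (x < y)}.
  move=> wm x y; rewrite !(mem_perm_iota _ wm) /ordb /f; lia.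
rewrite -(size_map (map f) (dwords m d e)); apply: uniq_leq_size.
  rewrite map_inj_in_uniq; first by rewrite !filter_uniq ?permutations_uniq.
  move=> u v; rewrite !mem_filter !mem_permutations.
  move=> /and3P[_ _ um] /and3P[_ _ vm] h.
  suff fK w : perm_eq w (iota 0 m) -> [seq f x | x <- [seq f x | x <- w]] = w.
    by rewrite -(fK u um) h fK.
  move=> wm; rewrite -map_comp -[RHS]map_id; apply/eq_in_map => x.
  by rewrite (mem_perm_iota _ wm) /f /=; lia.
move=> _ /mapP[w + ->]; rewrite !mem_filter !mem_permutations.
case/and3P => dw /andP[sw aw] wm.
rewrite (perm_iota_compl wm) (separable_map (fP w wm)) // andbT.
rewrite -[X in alt X]/(if false then d else ~~ d) (alt_map _ (fP w wm)) aw !andbT.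
case/decomposableP: dw => u [v [wE u0 v0 /allrelP uv]].
apply/decomposableP; exists (map f u), (map f v).
rewrite !size_map -map_cat -wE; split => //.
apply/allrelP => _ _ /mapP[x xu ->] /mapP[y yv ->].
have := uv x y xu yv.
have [xw yw] : x \in w /\ y \in w by rewrite wE !mem_cat xu yv orbT.
by move: xw yw; rewrite !(mem_perm_iota _ wm) /ordb /f; case: (e) => /=; lia.
Qed.

(** Words of length at least two are sums or skew sums, never both; complementation turns the skew
    sums into sums starting in the other direction. *)
Lemma size_words_split m b :
  1 < m -> size (words m b) = size (dwords m b true) + size (dwords m (~~ b) true).
Proof.
move=> m1; rewrite (size_dwords_compl m (~~ b)) negbK /=.
rewrite /dwords !(size_filter _ (words _ _)) -(count_predC (decomposable true)).
congr (_ + _); apply: eq_in_count => w wW /=.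
apply/idP/idP => [nd|]; last first.
  by apply: contraTN => /decomposable_disjoint.
have := size_words_perm wW; move: wW; rewrite mem_words => /and3P[sw _ wm] szw.
have wu : uniq w by rewrite (perm_uniq wm) iota_uniq.
have [] := separable_decomposable wu sw; first by rewrite szw.
by case=> // h; rewrite h in nd.
Qed.

Lemma size_iwords m b : 1 < m -> size (iwords m b) = size (dwords m (~~ b) true).
Proof.
move=> m1; apply/eqP; rewrite -(eqn_add2l (size (dwords m b true))).
rewrite -size_words_split // /dwords /iwords !(size_filter _ (words _ _)).
by rewrite -[X in _ + X]/(count (predC (decomposable true)) _) count_predC.
Qed.

Lemma words1 b : words 1 b = [:: [:: 0]].
Proof. by case: b. Qed.

Lemma size_wordsN m b : size (words m (~~ b)) = size (words m b).
Proof.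
case: m => [|[|m]]; [by case: b | by rewrite !words1 |].
by rewrite !size_words_split // negbK addnC.
Qed.

(** * Unique factorization of sums at the shortest cut *)

Lemma perm_iota_cat m u v :
    perm_eq (u ++ v) (iota 0 m) -> allrel (ordb true) u v ->
  perm_eq u (iota 0 (size u)) /\ perm_eq v (iota (size u) (m - size u)).
Proof.
move=> uvm uv.
have szm : size u + size v = m.
  by rewrite -size_cat (perm_size uvm) size_iota.
(* Sorting both parts separately already sorts the whole word, since [u] lies below [v]. *)
have sE : sort leq u ++ sort leq v = iota 0 m.
  apply: (sorted_eq leq_trans anti_leq).
  - rewrite (sorted_pairwise leq_trans) pairwise_cat.
    rewrite -!(sorted_pairwise leq_trans) !sort_sorted ?andbT; try exact: leq_total.
    apply/allrelP => x y; rewrite !mem_sort => xu yv.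
    by apply: ltnW; apply: (allrelP uv).
  - exact: iota_sorted.
  - by apply: perm_trans uvm; rewrite perm_cat // perm_sort.
have : iota 0 m = iota 0 (size u) ++ iota (size u) (m - size u).
  by rewrite -iotaD; congr iota; lia.
rewrite -sE => /eqP; rewrite eqseq_cat ?size_sort ?size_iota //.
by case/andP => /eqP <- /eqP <-; rewrite !(perm_sym _ (sort _ _)) !perm_sort.
Qed.

Definition osum (k : nat) (p : seq nat * seq nat) := p.1 ++ map (addn k) p.2.

(** By [alt_cat] with [c] true, the prefix length must have parity [b] and the suffix must start
    downwards. *)
Definition osums m b := [seq osum k p |
  k <- [seq k <- iota 1 m.-1 | odd k == b],
  p <- [seq (u, v) | u <- iwords k b, v <- words (m - k) false]].

(** Of two factorizations with prefixes of different lengths, the shorter prefix would cut the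
    longer one into a sum, which [iwords] excludes. So the lengths agree, and the factors with
    them. *)
Lemma osums_uniq m b : uniq (osums m b).
Proof.
apply: allpairs_uniq_dep => [|k _|].
- by rewrite filter_uniq // iota_uniq.
- apply: allpairs_uniq => [||[? ?] [? ?] _ _ /=] //; last exact: words_uniq.
  exact/filter_uniq/words_uniq.
have lt_cat l s t : perm_eq s (iota 0 l) -> allrel (ordb true) s (map (addn l) t).
  move=> sl; apply/allrelP => x _ xs /mapP[y _ ->]; rewrite /ordb /=.
  by move: xs; rewrite (mem_perm_iota _ sl); lia.
have aux l1 s1 t1 l2 s2 t2 : perm_eq s1 (iota 0 l1) -> perm_eq s2 (iota 0 l2) ->
    0 < l1 -> ~~ decomposable true s2 -> osum l1 (s1, t1) = osum l2 (s2, t2) ->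
    l2 <= l1.
  move=> p1 p2 l0 + eq12; rewrite leqNgt; apply: contraNN => l12.
  have sz1 := perm_size p1; have sz2 := perm_size p2; rewrite !size_iota in sz1 sz2.
  have s2E : s2 = s1 ++ take (l2 - l1) (map (addn l1) t1).
    rewrite -(take_size_cat (map (addn l2) t2) sz2).
    by move: eq12; rewrite /osum /= => <-; rewrite take_cat sz1 ltnNge (ltnW l12).
  apply/decomposableP; exists s1, (take (l2 - l1) (map (addn l1) t1)).
  split; rewrite ?sz1 //; first by rewrite -(ltn_add2l (size s1)) -size_cat -s2E; lia.
  apply/allrelP => x y xs /mem_take ys.
  exact: (allrelP (lt_cat _ _ _ p1)) xs ys.
have memP (p : {k : nat & (seq nat * seq nat)%type}) :
    p \in [seq existT (fun _ => (seq nat * seq nat)%type) x y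
         | x <- [seq k <- iota 1 m.-1 | odd k == b],
           y <- [seq (u, v) | u <- iwords x b, v <- words (m - x) false]] ->
    exists k u v, [/\ p = existT _ k (u, v), 0 < k,
      perm_eq u (iota 0 k) & ~~ decomposable true u].
  case/allpairsPdep => k [q [+ /allpairsP[[u v] /= [+ _ ->]] ->]].
  rewrite !mem_filter mem_iota mem_permutations.
  by move=> /and3P[_ k0 _] /and3P[nu _ uk]; exists k, u, v.
move=> _ _ /memP[k [u [v [-> k0 uk nu]]]] /memP[k' [u' [v' [-> k0' uk' nu']]]] /= E.
have kk : k = k'.
  by apply/eqP; rewrite eqn_leq (aux _ _ _ _ _ _ uk' uk k0' nu (esym E))
    (aux _ _ _ _ _ _ uk uk' k0 nu' E).
case: _ / kk E uk' => /eqP; rewrite /osum /= => + uk'.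
rewrite eqseq_cat; last by rewrite (perm_size uk) (perm_size uk').
by case/andP => /eqP -> /eqP/(inj_map (@addnI k)) ->.
Qed.

Lemma mem_osums m b : osums m b =i dwords m b true.
Proof.
move=> w; apply/allpairsPdep/idP => [[k [q []]]|].
  rewrite mem_filter mem_iota => /and3P[/eqP kb k0 km].
  case/allpairsP => -[u v] /= []; rewrite /iwords !mem_filter !mem_permutations.
  move=> /and3P[_ /andP[su au] uk] /andP[/andP[sv av] vk] -> ->.
  have uv : allrel (ordb true) u (map (addn k) v).
    apply/allrelP => x _ xs /mapP[y _ ->]; rewrite /ordb /=.
    by move: xs; rewrite (mem_perm_iota _ uk); lia.
  have fP : {in v &, forall x y, ordb true (k + x) (k + y) = (x < y)}.
    by move=> x y _ _; rewrite /ordb ltn_add2l.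
  have szu : size u = k by rewrite (perm_size uk) size_iota.
  have szv : size v = m - k by rewrite (perm_size vk) size_iota.
  rewrite /osum /= (separable_cat uv) ?(separable_map fP) //.
  rewrite (alt_cat _ _ _ uv) ?size_map ?szu ?szv ?subn_gt0 //; last by lia.
  rewrite au -kb addbb /= -[X in alt X]/(if true then false else true).
  rewrite (alt_map _ fP) av /=; apply/andP; split.
    apply/decomposableP; exists u, (map (addn k) v).
    by rewrite size_map szu szv; split => //; lia.
  have -> : iota 0 m = iota 0 k ++ map (addn k) (iota 0 (m - k)).
    by rewrite -iotaDl addn0 -iotaD; congr iota; lia.
  by rewrite perm_cat ?perm_map.
rewrite /dwords mem_filter mem_words => /andP[dw /and3P[sw aw wm]].
have wsz : size w = m by rewrite (perm_size wm) size_iota.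
(* The least cut is chosen: a cut of the prefix would give a smaller cut of [w], so the prefix is
   not a sum. *)
have exk : exists k, cut true w k.
  by case/hasP: dw => k _ kc; exists k.
case: (ex_minnP exk) => k /and3P[k0 kw kc] kmin.
have km : k < m by rewrite -wsz.
have szu : size (take k w) = k by rewrite size_takel // ltnW.
have szv : size (drop k w) = m - k by rewrite size_drop wsz.
move: wm aw; rewrite -{1 2}(cat_take_drop k w) => wm.
rewrite (alt_cat _ _ _ kc) ?szu ?szv //; last by rewrite subn_gt0.
case/and3P => au av kb.
have [uk vk] := perm_iota_cat wm kc; rewrite szu in uk vk.
have kbE : odd k = b by move: kb; case: (b) (odd k) => [] [].
pose v := map (subn^~ k) (drop k w).
have vE : drop k w = map (addn k) v.
  rewrite -map_comp -[LHS]map_id; apply/eq_in_map => x.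
  by rewrite (perm_mem vk) mem_iota /=; lia.
have fP : {in drop k w &, forall x y, ordb true (x - k) (y - k) = (x < y)}.
  by move=> x y; rewrite !(perm_mem vk) !mem_iota /ordb; lia.
exists k, (take k w, v); split; last by rewrite /osum /= -vE cat_take_drop.
  by rewrite mem_filter kbE eqxx mem_iota; lia.
apply/allpairsP; exists (take k w, v); split => //=.
  rewrite /iwords mem_filter mem_words uk au (separable_subseq (take_subseq _ _) sw) !andbT.
  apply/decomposableP => -[u1 [u2 [uE u10 u20 u12]]].
  have szu12 : size u1 + size u2 = k by rewrite -size_cat -uE szu.
  suff /kmin : cut true w (size u1) by lia.
  have wE : w = u1 ++ (u2 ++ drop k w) by rewrite catA -uE cat_take_drop.
  rewrite wE /cut u10 take_size_cat // drop_size_cat // allrel_catr u12.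
  move: kc; rewrite uE allrel_catl => /andP[-> _].
  by rewrite !size_cat andbT -[X in X < _]addn0 ltn_add2l addn_gt0 u20.
rewrite mem_words (separable_map fP) ?(separable_subseq (drop_subseq _ _) sw) //.
rewrite -[X in alt X]/(if true then false else true) (alt_map _ fP).
move: av; rewrite -kbE addbb => -> /=.
by apply: (perm_map_inj (@addnI k)); rewrite -vE -iotaDl addn0.
Qed.

Lemma size_dwordsE m b :
  size (dwords m b true) =
  \sum_(1 <= k < m | odd k == b) size (iwords k b) * size (words (m - k) false).
Proof.
rewrite -(perm_size (uniq_perm (osums_uniq m b) _ (mem_osums m b))); last first.
  exact/filter_uniq/words_uniq.
rewrite size_allpairs_dep sumnE big_map big_filter /index_iota subn1.
by apply: eq_bigr => k _; rewrite size_allpairs.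
Qed.

(** * From permutations to words *)

Lemma altP b w :
  reflect (forall i, i.+1 < size w ->
             ordb (b (+) odd i) (nth 0 w i) (nth 0 w i.+1))
          (alt b w).
Proof.
elim: w b => [|x [|y w] IH] b; [by left | by left |].
have -> : alt b [:: x, y & w] = ordb b x y && alt (~~ b) (y :: w) by [].
apply: (iffP andP) => [[xy /IH h] [_|i iw]|h]; first by rewrite addbF.
  by have := h i iw; rewrite addNb -addbN.
split; first by have := h 0 isT; rewrite addbF.
by apply/IH => i iw; rewrite addNb -addbN; apply: (h i.+1).
Qed.

Definition perm_word m (s : 'S_m) : seq nat := [seq val (s i) | i <- enum 'I_m].

Lemma size_perm_word m (s : 'S_m) : size (perm_word s) = m.
Proof. by rewrite size_map size_enum_ord. Qed.

Lemma nth_perm_word m (s : 'S_m) (i : 'I_m) : nth 0 (perm_word s) i = s i.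
Proof. by rewrite (nth_map i) ?size_enum_ord // nth_ord_enum. Qed.

Lemma perm_word_inj m : injective (@perm_word m).
Proof.
move=> s t st; apply/permP => i; apply: val_inj.
by rewrite /= -!nth_perm_word st.
Qed.

Lemma perm_word_perm m (s : 'S_m) : perm_eq (perm_word s) (iota 0 m).
Proof.
apply: uniq_perm; rewrite ?iota_uniq //.
  by rewrite map_inj_uniq ?enum_uniq // => i j /val_inj/perm_inj.
move=> x; rewrite mem_iota /= add0n; apply/mapP/idP => [[i _ ->]|xm].
  exact: ltn_ord.
by exists (s^-1 (Ordinal xm))%g; rewrite ?mem_enum // permKV.
Qed.

Lemma perm_word_surj m w :
  perm_eq w (iota 0 m) -> exists s : 'S_m, w = perm_word s.
Proof.
move=> wm; have szw : size w = m by rewrite (perm_size wm) size_iota.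
have wlt (i : 'I_m) : nth 0 w i < m.
  by rewrite -(mem_perm_iota _ wm) mem_nth ?szw.
have f_inj : injective (fun i => Ordinal (wlt i)).
  move=> i j [] /eqP; rewrite nth_uniq ?szw //; first by move/eqP/val_inj.
  by rewrite (perm_uniq wm) iota_uniq.
exists (perm f_inj); apply: (@eq_from_nth _ 0); first by rewrite size_perm_word.
by move=> i; rewrite szw => im; rewrite (nth_perm_word _ (Ordinal im)) permE.
Qed.

Lemma alternating_word m (s : 'S_m) : alternating s = alt true (perm_word s).
Proof.
apply/'forall_forallP/altP => h i; rewrite ?size_perm_word.
  move=> im; pose a := Ordinal (ltnW im); pose b := Ordinal im.
  have := h a b; rewrite /= eqxx /= (nth_perm_word _ a) (nth_perm_word _ b).
  by rewrite /ordb; case: odd.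
move=> j; apply/implyP => /eqP ji; have := h i.
rewrite size_perm_word -ji ltn_ord !nth_perm_word => /(_ isT).
by rewrite /ordb; case: odd.
Qed.

(** The enumeration is strictly increasing, and a strictly increasing list is recovered from it by
    filtering on membership. *)
Lemma subseq_enum_ord m (i j k l : 'I_m) :
  subseq [:: i; j; k; l] (enum 'I_m) = [&& i < j, j < k & k < l].
Proof.
have lt_trans : transitive (fun x y : 'I_m => x < y) by move=> ? ? ?; apply: ltn_trans.
have sE : sorted (fun x y : 'I_m => x < y) (enum 'I_m).
  by have := iota_ltn_sorted 0 m; rewrite -val_enum_ord sorted_map.
apply/idP/idP => [h|ijkl].
  by have := subseq_sorted lt_trans h sE; rewrite /= andbT.
have sI : sorted (fun x y : 'I_m => x < y) [:: i; j; k; l].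
  by rewrite /= andbT.
have lt_irr : irreflexive (fun x y : 'I_m => x < y) by move=> ?; apply: ltnn.
have -> : [:: i; j; k; l] = [seq x <- enum 'I_m | x \in [:: i; j; k; l]].
  apply: (irr_sorted_eq lt_trans lt_irr) => //.
    exact: sorted_filter.
  by move=> x; rewrite mem_filter mem_enum andbT.
exact: filter_subseq.
Qed.

Lemma separable_word m (s : 'S_m) :
  separable (perm_word s) = ~~ contains2413 s && ~~ contains3142 s.
Proof.
rewrite -negb_or; apply/separableP/idP => [h|].
  apply/negP => /orP[] /'exists_'exists_'exists_existsP[i [j [k [l]]]];
  case/and5P => ij jk kl h1 /andP[h2 h3];
  have := h (s i) (s j) (s k) (s l);
  rewrite (map_subseq (fun i => val (s i)) (s1 := [:: i; j; k; l])) ?subseq_enum_ord ?ij ?jk //;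
  by rewrite /bad4 /pat4 /ordb h1 h2 h3 ?orbT => /(_ isT).
move=> nc a1 a2 a3 a4; case/subseq_map_exists.
move=> [|i [|j [|k [|l []]]]] // + [-> -> -> ->].
rewrite subseq_enum_ord => /and3P[ij jk kl].
apply: contra nc => /orP[] /and3P[h1 h2 h3]; apply/orP; [left | right];
  apply/existsP; exists i; apply/existsP; exists j; apply/existsP; exists k;
  by apply/existsP; exists l; apply/and5P; split => //; apply/andP.
Qed.

Lemma card_Aset m : #|Aset m| = size (words m true).
Proof.
rewrite cardE -(size_map (@perm_word m)); apply/perm_size/uniq_perm.
- by rewrite map_inj_uniq ?enum_uniq //; apply: perm_word_inj.
- exact: words_uniq.
move=> w; rewrite mem_words; apply/mapP/and3P => [[s]|[sw aw wm]].
  rewrite mem_enum inE alternating_word -separable_word => /andP[aw sw] ->.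
  by rewrite perm_word_perm.
have [s wE] := perm_word_surj wm; exists s => //.
by rewrite mem_enum inE alternating_word -separable_word -wE aw.
Qed.

(** * Recurrences by half-length *)

Lemma sum_odd n F :
  (\sum_(1 <= k < n.*2.+1 | odd k) F k = \sum_(i < n) F i.*2.+1) /\
  (\sum_(1 <= k < n.*2 | odd k) F k = \sum_(i < n) F i.*2.+1).
Proof.
have up l : \sum_(1 <= k < l.*2.+1 | odd k) F k = \sum_(i < l) F i.*2.+1.
  elim: l => [|l IH]; first by rewrite big_nil big_ord0.
  rewrite doubleS big_mkcond big_nat_recr //= big_nat_recr //= -big_mkcond IH.
  by rewrite odd_double /= addn0 big_ord_recr.
split=> //; rewrite -up; case: n => [|n]; first by rewrite !big_nil.
rewrite doubleS [RHS]big_mkcond [RHS]big_nat_recr //= negbK odd_double addn0.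
by rewrite -big_mkcond.
Qed.

Lemma sum_even n F :
  (\sum_(1 <= k < n.*2.+1 | ~~ odd k) F k = \sum_(1 <= i < n.+1) F i.*2) /\
  (\sum_(1 <= k < n.*2 | ~~ odd k) F k = \sum_(1 <= i < n) F i.*2).
Proof.
have up l : \sum_(1 <= k < l.*2.+1 | ~~ odd k) F k = \sum_(1 <= i < l.+1) F i.*2.
  elim: l => [|l IH]; first by rewrite !big_nil.
  rewrite doubleS big_mkcond big_nat_recr //= big_nat_recr //= -big_mkcond IH.
  by rewrite odd_double /= addn0 [RHS]big_nat_recr.
split=> //; case: n => [|n]; first by rewrite !big_nil.
rewrite -up doubleS [LHS]big_mkcond [LHS]big_nat_recr //= odd_double addn0.
by rewrite -big_mkcond.
Qed.

(* Coefficients of the series [Q], [C] and [E] above. *)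
Definition cnt_q n := size (iwords n.*2.+1 true).
Definition cnt_c n := size (dwords n.*2 true true).
Definition cnt_e n := if n is 0 then 0 else size (words n.*2 false).

(** The passage to words starting downwards is made because suffixes behind a sum cut have this
    form. *)
Lemma rE n : r n = size (words n.*2.+1 false).
Proof. by rewrite /r card_Aset mul2n -(size_wordsN _ true). Qed.

Lemma cnt_c0 : cnt_c 0 = 0.
Proof. by []. Qed.

(** A non-sum of positive even length is a skew sum; if it starts downwards, its complement is a sum
    starting upwards. *)
Lemma cnt_c_iwords n : 0 < n -> size (iwords n.*2 false) = cnt_c n.
Proof. by case: n => // n _; rewrite size_iwords. Qed.

(** Beyond length one, the sums starting downwards are as many as the non-sums starting upwards,
    which gives [cnt_q n]. The sums starting upwards are cut after an odd prefix and leave an even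
    suffix. *)
Lemma r_rec n : r n = cnt_q n + \sum_(i < n.+1) cnt_q i * cnt_e (n - i).
Proof.
rewrite big_ord_recr /= subnn muln0 addn0 rE.
case: n => [|n]; first by rewrite big_ord0 words1 /cnt_q /iwords words1.
rewrite size_words_split //; congr (_ + _).
  by rewrite /cnt_q size_iwords.
rewrite size_dwordsE (eq_bigl odd) => [|k]; last by rewrite eqb_id.
rewrite (sum_odd n.+1 _).1; apply: eq_bigr => i _; congr (_ * _).
rewrite subSS -doubleB; have := ltn_ord i; rewrite -subn_gt0.
by case: (n.+1 - i).
Qed.

(** The single letter gives the term [n == 0]. A longer non-sum complements to a sum starting
    downwards, cut after an even prefix. *)
Lemma q_rec n : cnt_q n = (n == 0) + \sum_(i < n.+1) cnt_c i * r (n - i).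
Proof.
rewrite big_ord_recl /= cnt_c0 mul0n add0n.
case: n => [|n]; first by rewrite big_ord0 /cnt_q /iwords words1.
rewrite /cnt_q size_iwords // size_dwordsE (eq_bigl (fun k => ~~ odd k)); last first.
  by move=> k; rewrite eqbF_neg.
rewrite (sum_even n.+1 _).1 big_add1 big_mkord; apply: eq_bigr => i _.
rewrite cnt_c_iwords // rE; congr (_ * size (words _ _)).
by rewrite /bump /=; case: i => i /= ii; lia.
Qed.

(** A sum of even length starting upwards is cut into two odd pieces, whence the shift by one. *)
Lemma c_rec n : cnt_c n.+1 = \sum_(i < n.+1) cnt_q i * r (n - i).
Proof.
rewrite /cnt_c size_dwordsE (eq_bigl odd) => [|k]; last by rewrite eqb_id.
rewrite (sum_odd n.+1 _).2; apply: eq_bigr => i _.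
rewrite rE; congr (_ * size (words _ _)).
by case: i => i /= ii; lia.
Qed.

Lemma e_rec n : cnt_e n = cnt_c n + \sum_(i < n.+1) cnt_c i * cnt_e (n - i).
Proof.
case: n => [|n]; first by rewrite big_ord1.
rewrite big_ord_recl big_ord_recr /= cnt_c0 mul0n add0n subnn muln0 addn0.
rewrite size_words_split // addnC; congr (_ + _).
rewrite size_dwordsE (eq_bigl (fun k => ~~ odd k)); last first.
  by move=> k; rewrite eqbF_neg.
rewrite (sum_even n.+1 _).2 big_add1 big_mkord; apply: eq_bigr => i _.
rewrite cnt_c_iwords //; congr (_ * _).
rewrite -doubleB /bump /= add1n; have := ltn_ord i; rewrite -subn_gt0 subSS.
by case: (n - i).
Qed.

End Words.

(** * Truncated generating series *)

Definition ser (N : nat) (f : nat -> nat) : {poly int} := \poly_(i < N.+1) (f i)%:R.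

Lemma coef_ser N f n : (n <= N)%N -> (ser N f)`_n = (f n)%:R.
Proof. by move=> nN; rewrite coef_poly ltnS nN. Qed.

Lemma coef_serM N f g n : (n <= N)%N ->
  (ser N f * ser N g)`_n = (\sum_(i < n.+1) f i * g (n - i))%N%:R.
Proof.
move=> nN; rewrite coefM natr_sum; apply: eq_bigr => i _.
by rewrite natrM !coef_ser // ?(leq_trans (leq_subr _ _)) // (leq_trans _ nN) // -ltnS.
Qed.

(** An explicit multiple of ['X^(N.+1)] turns congruences of truncated series into polynomial
    equations, to which [ring] applies. *)
Lemma modXn_of_coef N (p q : {poly int}) : (forall n, (n <= N)%N -> p`_n = q`_n) ->
  exists t, p = q + t * 'X^(N.+1).
Proof.
move=> h; exists (drop_poly N.+1 (p - q)).
have := poly_take_drop N.+1 (p - q).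
have -> : take_poly N.+1 (p - q) = 0.
  apply/polyP => i; rewrite coef_take_poly coef0 ltnS coefB.
  by case: ifP => // /h ->; rewrite subrr.
by rewrite add0r => ->; rewrite addrC subrK.
Qed.

Lemma coef_of_modXn N (p q t : {poly int}) n : (n <= N)%N ->
  p = q + t * 'X^(N.+1) -> p`_n = q`_n.
Proof. by move=> nN ->; rewrite coefD coefMXn ltnS nN addr0. Qed.

(* [E = C(1 + E) = 'X Q A (1 + E) = 'X A^2] and [Q (1 - 'X A^2) = 1], whence
   [A (1 - 'X A^2) = Q (1 + E) (1 - 'X A^2) = 1 + 'X A^2]. *)
Lemma ser_r_eq N n : (n <= N)%N ->
  (ser N r)`_n = (1 + 'X * ser N r ^+ 2 + 'X * ser N r ^+ 3)`_n.
Proof.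
move=> nN; set A := ser N r.
pose Q := ser N cnt_q; pose C := ser N cnt_c; pose E := ser N cnt_e.
have [t1 AE] : exists t, A = Q + Q * E + t * 'X^(N.+1).
  by apply: modXn_of_coef => i iN; rewrite coefD coef_serM // !coef_ser // r_rec natrD.
have [t2 QE] : exists t, Q = 1 + C * A + t * 'X^(N.+1).
  apply: modXn_of_coef => i iN; rewrite coefD coef_serM // !coef_ser // q_rec natrD.
  by rewrite coef1.
have [t3 CE] : exists t, C = 'X * (Q * A) + t * 'X^(N.+1).
  apply: modXn_of_coef => -[|i] iN; rewrite coefXM coef_ser //= c_rec.
  by rewrite coef_serM // ltnW.
have [t4 EE] : exists t, E = C + C * E + t * 'X^(N.+1).
  by apply: modXn_of_coef => i iN; rewrite coefD coef_serM // !coef_ser // e_rec natrD.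
(* [t5] collects the truncation errors of the elimination that expresses [E] through [A]. *)
pose t5 := - ('X * A * t1) + t3 * (1 + E) + t4.
apply: (coef_of_modXn (t := (1 + 'X * A ^+ 2) * (t3 * A + t2)
  + (Q * t5 + t1) * (1 - 'X * A ^+ 2)) nN).
set Z := 'X^(N.+1) in AE QE CE EE *.
have E2 : E - ('X * A ^+ 2 + t5 * Z) = 0.
  have -> : E - ('X * A ^+ 2 + t5 * Z) =
      (E - (C + C * E + t4 * Z)) + (1 + E) * (C - ('X * (Q * A) + t3 * Z))
      - 'X * A * (A - (Q + Q * E + t1 * Z)) by rewrite /t5; ring.
  by rewrite -EE -CE -AE !subrr !mulr0 addr0 subr0.
apply/eqP; rewrite -subr_eq0; apply/eqP.
(* The difference of the two sides is a combination of four relations, each equal to zero. *)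
transitivity ((1 - 'X * A ^+ 2) * (A - (Q + Q * E + t1 * Z))
  + Q * (1 - 'X * A ^+ 2) * (E - ('X * A ^+ 2 + t5 * Z))
  + (1 + 'X * A ^+ 2) * (Q - (1 + C * A + t2 * Z))
  + (1 + 'X * A ^+ 2) * A * (C - ('X * (Q * A) + t3 * Z))); first by ring.
by rewrite E2 -QE -CE -AE !subrr !mulr0 !addr0.
Qed.

Lemma r0 : r 0 = 1%N.
Proof. by rewrite rE words1. Qed.

Lemma Rtrunc_ser N : Rtrunc N + 1 = ser N r.
Proof.
rewrite /ser poly_def -(big_mkord xpredT (fun i => (r i)%:R *: 'X^i)).
by rewrite big_nat_recl // r0 expr0 scale1r addrC /Rtrunc big_add1.
Qed.

Lemma Rtrunc_eq N n : (n <= N)%N ->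
  (Rtrunc N)`_n = ('X * (Rtrunc N + 1) ^+ 2 + 'X * (Rtrunc N + 1) ^+ 3)`_n.
Proof.
move=> nN; have -> : Rtrunc N = ser N r - 1 by rewrite -Rtrunc_ser addrK.
rewrite subrK coefB ser_r_eq // -addrA coefD.
by rewrite addrAC subrr add0r.
Qed.

(** * Lagrange inversion and the closed form *)

Definition phi : {poly int} := (1 + 'X) ^+ 2 * (2%:R + 'X).

Lemma deriv_phi : phi^`() = 5%:R + 8%:R * 'X + 3%:R * 'X ^+ 2.
Proof.
have -> : phi = 2%:P + 'X *+ 5 + 'X^2 *+ 4 + 'X^3.
  by rewrite /phi -(rmorph_nat polyC); ring.
by rewrite !derivD derivC !derivXn derivX /=; ring.
Qed.

Lemma coef_XexpDn (c : int) n j : ((c%:P + 'X) ^+ n)`_j = c ^+ (n - j) *+ 'C(n, j).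
Proof.
rewrite exprDn.
under eq_bigr => i _ do rewrite -rmorphXn /= mul_polyC scalerMnl.
rewrite -(poly_def n.+1 (fun i => c ^+ (n - i) *+ 'C(n, i))) coef_poly ltnS.
by case: leqP => // nj; rewrite bin_small.
Qed.

(* Since [R^(k+1) = x R^k phi(R)], both sides satisfy the same linear recurrence
   in [n] (for the right-hand side, because ['X F^`()] has [n]-th coefficient
   [n F_n], applied to [F = 'X^k phi^(n+1)]), so no inversion of power series is
   needed. *)
Lemma lagrange_Rtrunc N n k : (n <= N)%N ->
  (Rtrunc N ^+ k)`_n *+ n = ('X^k * phi ^+ n)`_n *+ k.
Proof.
set P := Rtrunc N.
have P0 : P`_0 = 0 by rewrite /P Rtrunc_eq // coefD !coefXM.
elim: n k => [|n IH] k nN.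
  by case: k => [|k] //; rewrite mulr0n expr0 mulr1 coefXn mul0rn.
case: k => [|k]; first by rewrite expr0 coef1 mul0rn mulr0n.
have [t PE] := modXn_of_coef (@Rtrunc_eq N); rewrite -/P in PE.
(* The weights 2, 5, 4, 1 are the coefficients of [phi]. *)
have PkE : (P ^+ k.+1)`_n.+1 = (P ^+ k)`_n *+ 2 + (P ^+ k.+1)`_n *+ 5
    + (P ^+ k.+2)`_n *+ 4 + (P ^+ k.+3)`_n.
  have -> : (P ^+ k.+1)`_n.+1 = ('X * (P ^+ k *+ 2 + P ^+ k.+1 *+ 5
      + P ^+ k.+2 *+ 4 + P ^+ k.+3))`_n.+1.
    apply: (coef_of_modXn (t := t * P ^+ k) nN).
    by rewrite exprS {1}PE !exprS; ring.
  by rewrite coefXM /= 3!coefD !coefMn.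
(* At [n = 0] the induction hypothesis is multiplied by zero and says nothing, so the constant
   coefficients are evaluated directly. *)
rewrite PkE; case: n IH nN {PkE} => [_ _|n IH nN].
  have Pk0 j : (P ^+ j)`_0 = (j == 0%N)%:R.
    by rewrite -horner_coef0 horner_exp horner_coef0 P0 expr0n.
  rewrite mulr1n expr1 !Pk0 [in RHS]exprS -mulrA coefXM -horner_coef0.
  rewrite hornerM hornerXn expr0n /phi !hornerE.
  by case: k => [|k]; rewrite /= ?mul0r ?mul0rn ?addr0.
rewrite [in RHS]exprS -mulrA coefXM /=.
(* This is the factor that the induction hypothesis carries on each coefficient of a power of
   [P]. *)
apply: (@mulIf _ n.+1%:R); first by rewrite pnatr_eq0.
pose F : {poly int} := 'X^k * phi ^+ n.+2.
(* [G] is ['X] times the derivative of ['X^k * phi]; its weights [k], [k.+1], [k.+2], [k.+3] are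
   those produced by the induction hypothesis. *)
pose G : {poly int} := 'X^k *+ (2 * k) + 'X^(k.+1) *+ (5 * k.+1) + 'X^(k.+2) *+ (4 * k.+2)
  + 'X^(k.+3) *+ k.+3.
have SE : G * phi ^+ n.+1 *+ n.+2 = F *+ (n.+1 * k) + 'X * F^`().
  have -> : 'X * F^`() = F *+ k + 'X^(k.+1) * phi^`() * phi ^+ n.+1 *+ n.+2.
    rewrite /F derivM derivXn deriv_exp /= mulrDr; congr (_ + _).
      case: (k) => [|j]; first by rewrite !mulr0n mul0r mulr0.
      by rewrite [in RHS]exprS mulrnAl mulrnAr mulrA.
    by rewrite mulrnAr mulrnAr [in RHS]exprS; congr (_ *+ _); ring.
  rewrite /F deriv_phi /G !(exprS phi) !(exprS 'X k.+2) !(exprS 'X k.+1) !(exprS 'X k).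
  by set x := 'X^k; set y := phi ^+ n; rewrite /phi; ring.
have {SE} := congr1 (fun p : {poly int} => p`_n.+1) SE.
rewrite coefMn coefD coefMn coefXM /= coef_deriv.
have -> : (G * phi ^+ n.+1)`_n.+1 = ((P ^+ k)`_n.+1 *+ 2 + (P ^+ k.+1)`_n.+1 *+ 5
    + (P ^+ k.+2)`_n.+1 *+ 4 + (P ^+ k.+3)`_n.+1) *+ n.+1.
  have IH' j c : (P ^+ j)`_n.+1 *+ c *+ n.+1
      = ('X^j * phi ^+ n.+1)`_n.+1 *+ (c * j).
    by rewrite mulrnAC IH ?(ltnW nN) // -mulrnA mulnC.
  rewrite 3!mulrnDl !IH' -[(P ^+ k.+3)`_n.+1]mulr1n IH' mul1n.
  by rewrite /G 3!mulrDl 3!coefD !mulrnAl !coefMn.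
rewrite -/F => SE; rewrite !mulr_natr -!mulrnA [(n.+2 * _)%N]mulnC mulrnA SE.
by rewrite -mulrnDr; congr (_ *+ _); lia.
Qed.

(** The case [k = 1] of Lagrange's formula asks for the coefficient of degree [n] in
    [(1 + 'X)^(2n+2) (2 + 'X)^(n+1)]. Each term of the convolution contains [2^(i+1)], whence the
    factor 2, and a binomial to be reflected by symmetry. *)
Lemma r_closed_form n :
  (n.+1 * r n.+1 =
   2 * \sum_(0 <= i < n.+1) 2 ^ i * 'C(2 * n.+1, i) * 'C(n.+1, i.+1))%N.
Proof.
apply/eqP; rewrite -(eqr_nat int) natrM mulr_natl; apply/eqP.
have := lagrange_Rtrunc 1 (leqnn n.+1); rewrite !expr1 mulr1n coefXM /=.
have -> : (Rtrunc n.+1)`_n.+1 = (r n.+1)%:R.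
  have -> : Rtrunc n.+1 = ser n.+1 r - 1 by rewrite -Rtrunc_ser addrK.
  by rewrite coefB coef_ser // coef1 subr0.
move=> ->; rewrite /phi exprMn -exprM.
have -> : 1 + 'X = 1%:P + 'X :> {poly int} by [].
have -> : 2%:R + 'X = 2%:P + 'X :> {poly int} by rewrite -(rmorph_nat polyC).
rewrite coefM natrM natr_sum mulr_sumr big_mkord; apply: eq_bigr => i _.
rewrite !coef_XexpDn expr1n.
have ni : (i <= n)%N by rewrite -ltnS.
have -> : (n.+1 - (n - i) = i.+1)%N by lia.
have -> : 'C(n.+1, n - i) = 'C(n.+1, i.+1).
  by rewrite -[RHS]bin_sub ?subSS.
by rewrite !natrM natrX exprS; ring.
Qed.

(* The formal power series identity R = x(R+1)^2 + x(R+1)^3 is stated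
   coefficientwise: for every N and every n <= N, the n-th coefficients
   agree when R is truncated at degree N (which determines all coefficients
   of degree <= N on both sides). *)
Theorem theorem6p1 :
  (forall N n : nat, (n <= N)%N ->
     (Rtrunc N)`_n =
     ('X * (Rtrunc N + 1) ^+ 2 + 'X * (Rtrunc N + 1) ^+ 3)`_n)
  /\ r 0 = 1%N
  /\ (forall n : nat, (1 <= n)%N ->
        ((r n)%:R : rat) =
        2%:R / n%:R *
          \sum_(0 <= i < n) (2 ^ i * 'C(2 * n, i) * 'C(n, i.+1))%:R).
Proof.
split; first exact: Rtrunc_eq.
split; first exact: r0.
case=> // n _; rewrite -natr_sum.
apply: (@mulfI _ n.+1%:R); first by rewrite pnatr_eq0.
by rewrite -natrM r_closed_form natrM mulrA mulrCA mulfV ?pnatr_eq0 // mulr1.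
Qed.
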